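(* Let $a,b,\delta,r$ be nonzero constants with $a^2\neq\delta^2$, $b^2\ne\delta^2$, let $c,\gamma$ be constants, and put $$p=\frac{c^2/r-\delta^2r}{a^2-\delta^2},\qquad q=\frac{c^2/r-\delta^2r}{b^2-\delta^2},\qquad \alpha=pa,\qquad \beta=qb .$$ Then $$u_{n,m}=\alpha n+\beta m+\gamma-\delta^{-1}\big(c^2/r-\delta^2r\big)\left(2-\frac{ab}{\delta(bn+am)+2ab}\right)$$ is a (rational) solution of the Q1 lattice equation $$p\,(u-\widehat u)(\widetilde u-\widehat{\widetilde u})-q\,(u-\widetilde u)(\widehat u-\widehat{\widetilde u})+\delta^2pq(p-q)=0,$$ at all $(n,m)\in\mathbb Z^2$ for which the denominators $\delta(bn'+am')+2ab$ do not vanish at the four points $(n',m')\in\{n,n+1\}\times\{m,m+1\}$.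
   Context: All quantities are complex. Shift notation on the $(n,m)$ lattice: $u=u_{n,m}$, $\widetilde u=u_{n+1,m}$, $\widehat u=u_{n,m+1}$, $\widehat{\widetilde u}=u_{n+1,m+1}$. *)

(* Defs.v *)
From mathcomp Require Import all_boot all_order all_algebra.
From mathcomp Require Import reals complex.

Set Implicit Arguments.
Unset Strict Implicit.
Unset Printing Implicit Defensive.

Import Order.TTheory GRing.Theory Num.Theory.
Local Open Scope ring_scope.

(* The complex field is R[i] for an arbitrary R : realType; a function on the
   (n, m) lattice is a total map u : int -> int -> R[i].  Division is total in
   the library (x / 0 = 0), so values of u at excluded points are junk and must
   be ruled out by hypotheses. *)

Definition Q1_holds_at (R : realType) (p q delta : R[i])
    (u : int -> int -> R[i]) (n m : int) : Prop :=
  p * (u n m - u n (m + 1)) * (u (n + 1) m - u (n + 1) (m + 1))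
  - q * (u n m - u (n + 1) m) * (u n (m + 1) - u (n + 1) (m + 1))
  + delta ^+ 2 * p * q * (p - q) = 0.

Definition lattice_den (R : realType) (a b delta : R[i]) (n m : int) : R[i] :=
  delta * (b * n%:~R + a * m%:~R) + 2 * a * b.

(* u is a rational function of (n, m) on dom: a quotient of two polynomials
   N, D in two variables, with D nonvanishing on dom.  The inner variable of
   {poly {poly R[i]}} is n and the outer one is m. *)
Definition rational_on (R : realType) (dom : int -> int -> Prop)
    (u : int -> int -> R[i]) : Prop :=
  exists N D : {poly {poly R[i]}}, forall n m : int, dom n m ->
    D.[(m%:~R)%:P].[n%:~R] != 0 /\
    u n m = N.[(m%:~R)%:P].[n%:~R] / D.[(m%:~R)%:P].[n%:~R].

(* Main.v *)
Require Import Defs.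
From mathcomp Require Import all_boot all_order all_algebra.
From mathcomp Require Import reals complex ring.

Set Implicit Arguments.
Unset Strict Implicit.
Unset Printing Implicit Defensive.

Import Order.TTheory GRing.Theory Num.Theory.
Local Open Scope ring_scope.

(* Write K = c^2/r - delta^2 r, A = a^2 - delta^2, B = b^2 - delta^2, and let D,
   D1, D2, D12 be the denominators at the four vertices.  After division by K^3,
   the part of Q1 free of D vanishes because
   b^2 A - a^2 B = - delta^2 (b^2 - a^2).  In the remaining part the terms of
   order D^-2 combine over D D1 D2 D12 with numerator
   (D1 - D2)(D12 - D) = delta^2 (b^2 - a^2), and this cancels the term of
   order D^-4. *)
Lemma Q1_rational_identity (F : fieldType) (a b d K x y g D : F) :
    d != 0 -> a ^+ 2 - d ^+ 2 != 0 -> b ^+ 2 - d ^+ 2 != 0 ->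
    D != 0 -> D + d * b != 0 -> D + d * a != 0 -> D + d * b + d * a != 0 ->
  let p := K / (a ^+ 2 - d ^+ 2) in
  let q := K / (b ^+ 2 - d ^+ 2) in
  let v x y D := p * a * x + q * b * y + g - d^-1 * K * (2 - a * b / D) in
  let v0 := v x y D in
  let v1 := v (x + 1) y (D + d * b) in
  let v2 := v x (y + 1) (D + d * a) in
  let v12 := v (x + 1) (y + 1) (D + d * b + d * a) in
  p * (v0 - v2) * (v1 - v12) - q * (v0 - v1) * (v2 - v12)
  + d ^+ 2 * p * q * (p - q) = 0.
Proof.
move=> d0 A0 B0 D0 D1 D2 D12 /=; field.
by rewrite d0 A0 B0 D0 D1 D2 D12.
Qed.

(** The denominator is affine in [n] and [m], so each shift adds a constant. The four vertex
    denominators thus become one value plus fixed increments, the form used in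
    [Q1_rational_identity]. *)
Lemma lattice_denSn (R : realType) (a b delta : R[i]) (n m : int) :
  lattice_den a b delta (n + 1) m = lattice_den a b delta n m + delta * b.
Proof. by rewrite /lattice_den intrD; ring. Qed.

Lemma lattice_denSm (R : realType) (a b delta : R[i]) (n m : int) :
  lattice_den a b delta n (m + 1) = lattice_den a b delta n m + delta * a.
Proof. by rewrite /lattice_den intrD; ring. Qed.

Theorem mainTheorem4 (R : realType) (a b delta r c gamma : R[i])
    (p q alpha beta : R[i]) (u : int -> int -> R[i])
    (a_neq0 : a != 0) (b_neq0 : b != 0)
    (delta_neq0 : delta != 0) (r_neq0 : r != 0)
    (a2_neq : a ^+ 2 != delta ^+ 2) (b2_neq : b ^+ 2 != delta ^+ 2)
    (def_p : p = (c ^+ 2 / r - delta ^+ 2 * r) / (a ^+ 2 - delta ^+ 2))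
    (def_q : q = (c ^+ 2 / r - delta ^+ 2 * r) / (b ^+ 2 - delta ^+ 2))
    (def_alpha : alpha = p * a) (def_beta : beta = q * b)
    (def_u : forall n m : int,
       u n m = alpha * n%:~R + beta * m%:~R + gamma
               - delta^-1 * (c ^+ 2 / r - delta ^+ 2 * r)
                 * (2 - a * b / lattice_den a b delta n m)) :
  (forall n m : int,
     lattice_den a b delta n m != 0 ->
     lattice_den a b delta (n + 1) m != 0 ->
     lattice_den a b delta n (m + 1) != 0 ->
     lattice_den a b delta (n + 1) (m + 1) != 0 ->
     Q1_holds_at p q delta u n m)
  /\ rational_on (fun n m => lattice_den a b delta n m != 0) u.
Proof.
split=> [n m|].
  rewrite /Q1_holds_at !def_u def_alpha def_beta def_p def_q.
  rewrite !(lattice_denSm, lattice_denSn) !intrD => D0 D1 D2.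
  (* In the goal, the increments at the opposite vertex must come in the order [delta * b],
     [delta * a]. *)
  rewrite addrAC => D12; rewrite (addrAC _ (delta * a)).
  by apply: Q1_rational_identity; rewrite // ?subr_eq0 // addrAC.
pose K := c ^+ 2 / r - delta ^+ 2 * r.
(* Used twice: for the denominator, and for the part of [u] outside the fraction. *)
have affine (x y z : R[i]) : exists P : {poly {poly R[i]}},
    forall n m, P.[m%:P].[n] = x * n + y * m + z.
  exists (y%:P%:P * 'X + (x%:P * 'X + z%:P)%:P) => n m.
  by rewrite !(hornerD, hornerM, hornerC, hornerX) addrA [y * m + _]addrC.
have [D evalD] := affine (delta * b) (delta * a) (2 * a * b).
have [L evalL] := affine alpha beta (gamma - delta^-1 * K * 2).
have denE n m : D.[(m%:~R)%:P].[n%:~R] = lattice_den a b delta n m.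
  by rewrite evalD /lattice_den; ring.
(* With the constant [- 2 K / delta] absorbed into [L], [u = L + delta^-1 K a b / D]; this is its
   numerator over [D]. *)
exists (L * D + (delta^-1 * K * (a * b))%:P%:P), D => n m D0.
rewrite !(hornerD, hornerM, hornerC) denE evalL; split=> //.
rewrite def_u -/K mulrDl mulfK // mulrBr mulrA.
by rewrite opprB addrCA addrC !addrA.
Qed.
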